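(* Let $P,Q$ be probability measures on a measurable space $(\Omega,\Sigma)$ with densities $p,q$ with respect to a dominating measure $\lambda$, let $\pi_p,\pi_q\in(0,1)$ be class probabilities with $\pi_p+\pi_q=1$, let $c\in\mathbb{R}$, and consider the straight line $c=\pi_q\alpha+\pi_p\beta$ in the $(\alpha,\beta)$-plane. The following two statements are equivalent: (i) $c=\pi_q\alpha+\pi_p\beta$ is a supporting line to the Neyman-Pearson boundary; (ii) $\mathrm{BER}=c$ under class probabilities $(\pi_p,\pi_q)$. The following two statements are equivalent: (iii) $c=\pi_q\alpha+\pi_p\beta$ is a lower bound of the Neyman-Pearson boundary; (iv) $\mathrm{BER}\ge c$ under class probabilities $(\pi_p,\pi_q)$. The following two statements are equivalent: (v) $c=\pi_q\alpha+\pi_p\beta$ is a supporting line to an upper bound of the Neyman-Pearson boundary; (vi) $\mathrm{BER}\le c$ under class probabilities $(\pi_p,\pi_q)$.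
   Context: Bayes error rate: under class probabilities $(\pi_p,\pi_q)$, $\mathrm{BER}=\min_{E\in\Sigma}\left\{\pi_q\int_E q\,d\lambda+\pi_p\int_{E^c}p\,d\lambda\right\}$. Tests: the hypotheses are $H_0$: $x$ is a sample from $Q$, and $H_1$: $x$ is a sample from $P$. A (possibly randomized) test is a measurable $\phi:\Omega\to[0,1]$, accepting $H_0$ with probability $\phi(x)$ and $H_1$ with probability $1-\phi(x)$; its false positive rate is $\alpha=\int(1-\phi)\,dQ$ and its false negative rate is $\beta=\int\phi\,dP$ (for a nonrandomized test with set $E$: $\alpha=Q(E)$, $\beta=P(E^c)$). The Neyman-Pearson region is the set of all $(\alpha,\beta)$ attained by tests, and the Neyman-Pearson boundary is the graph of $B(\alpha)=\min\{\beta:(\alpha,\beta)\text{ in the region}\}$, $\alpha\in[0,1]$. A line is a lower bound of the boundary if it lies below or on the graph of $B$ over $[0,1]$. An upper bound of the boundary is a convex function $g:[0,1]\to(-\infty,+\infty]$ with $g\ge B$. A supporting line to the graph of a function on $[0,1]$ is a line that lies below or on the graph and meets it in at least one point. In (v), ''an upper bound'' means that there exists such a $g$ which the line supports. *)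

(* Defs.v *)
From HB Require Import structures.
From mathcomp Require Import all_boot all_order all_algebra.
From mathcomp Require Import all_classical all_reals all_analysis.
Import Order.TTheory GRing.Theory Num.Theory.
Import numFieldNormedType.Exports.

Set Implicit Arguments.
Unset Strict Implicit.
Unset Printing Implicit Defensive.

Local Open Scope classical_set_scope.
Local Open Scope ring_scope.

(* The least element of S; when S has none the value is the junk default 0
   (it is not the infimum of S). *)
Definition minimum (R : realType) (S : set R) : R :=
  xget 0 [set m | S m /\ lbound S m].

Definition is_density d (T : measurableType d) (R : realType)
    (lambda : {measure set T -> \bar R}) (P : probability T R) (p : T -> R) :=
  [/\ measurable_fun setT p,
      (forall x, 0 <= p x) &
      forall A, measurable A -> P A = (\int[lambda]_(x in A) (p x)%:E)%E].

Definition BER d (T : measurableType d) (R : realType)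
    (lambda : {measure set T -> \bar R}) (p q : T -> R) (pi_p pi_q : R) : R :=
  minimum [set pi_q * (\int[lambda]_(x in E) q x)
             + pi_p * (\int[lambda]_(x in ~` E) p x) | E in @measurable d T].

(* phi x is the probability of accepting H0 (x comes from Q); the nonrandomized
   test with set E, which rejects H0 on E, is the indicator of ~` E. *)
Definition is_test d (T : measurableType d) (R : realType) (phi : T -> R) :=
  measurable_fun setT phi /\ forall x, 0 <= phi x <= 1.

Definition false_positive_rate d (T : measurableType d) (R : realType)
    (Q : probability T R) (phi : T -> R) : R :=
  \int[Q]_x (1 - phi x).

Definition false_negative_rate d (T : measurableType d) (R : realType)
    (P : probability T R) (phi : T -> R) : R :=
  \int[P]_x phi x.

Definition NP_region d (T : measurableType d) (R : realType)
    (P Q : probability T R) : set (R * R) :=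
  [set (false_positive_rate Q phi, false_negative_rate P phi)
     | phi in @is_test d T R].

(* Meaningful for alpha in [0, 1] only. *)
Definition NP_boundary d (T : measurableType d) (R : realType)
    (P Q : probability T R) (alpha : R) : R :=
  minimum [set beta | NP_region P Q (alpha, beta)].

Definition line (R : realType) (pi_p pi_q c : R) : set (R * R) :=
  [set ab | c = pi_q * ab.1 + pi_p * ab.2].

(* In the next four definitions a function [0, 1] -> (-oo, +oo] is a function
   R -> \bar R, of which only the values on [0, 1] are used. *)
Definition line_below (R : realType) (L : set (R * R)) (f : R -> \bar R) :=
  forall a b : R, 0 <= a <= 1 -> L (a, b) -> (b%:E <= f a)%E.

Definition supporting_line (R : realType) (L : set (R * R)) (f : R -> \bar R) :=
  line_below L f /\
  exists a b : R, [/\ 0 <= a <= 1, L (a, b) & b%:E = f a].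

(* At t = 0 or t = 1 the convention 0 * +oo = 0 makes the inequality trivial. *)
Definition convex_on_unit (R : realType) (g : R -> \bar R) :=
  forall x y t : R, 0 <= x <= 1 -> 0 <= y <= 1 -> 0 <= t <= 1 ->
    (g ((t * x + (1 - t) * y)%R) <= t%:E * g x + (1 - t)%:E * g y)%E.

Definition boundary_upper_bound (R : realType) (B : R -> R) (g : R -> \bar R) :=
  [/\ (forall a : R, 0 <= a <= 1 -> (-oo < g a)%E),
      convex_on_unit g &
      forall a : R, 0 <= a <= 1 -> ((B a)%:E <= g a)%E].

(* Main.v *)
Require Import Defs.
From HB Require Import structures.
From mathcomp Require Import all_boot all_order all_algebra.
From mathcomp Require Import all_classical all_reals all_analysis.
From mathcomp Require Import measurable_realfun simple_functions.
From mathcomp Require Import ring lra.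
Import Order.TTheory GRing.Theory Num.Theory.
Import numFieldNormedType.Exports.
Local Open Scope classical_set_scope.
Local Open Scope ring_scope.

(** The weighted error [pi_q * alpha + pi_p * beta] is the risk of a test under
the class probabilities, and the BER is the least risk among all tests,
randomized ones included.  Indeed the risk of [phi] is the [lambda]-integral of
[(1 - phi) * (pi_q * q) + phi * (pi_p * p)], which is smallest when [phi]
accepts H0 exactly where [pi_p * p <= pi_q * q]; this Bayes test is
nonrandomized, so it is one of the competitors in the definition of the BER
([BER_min_risk]).

A line of slope [- pi_q / pi_p] is a level set of the risk, so the three
equivalences compare the level [c] with the least risk, provided that the
boundary consists of errors of actual tests.  This proviso matters: if at some
[alpha] the minimum defining [NP_boundary] were not attained, its value there
would be the meaningless default 0.  It is attained by the Neyman-Pearson lemma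
([neyman_pearson]).  For [0 < alpha <= 1] there is a likelihood-ratio threshold
[k] with [Q (p > k q) <= alpha <= Q (p >= k q)] ([likelihood_threshold]);
randomizing on the tie [p = k q] gives a test of level exactly [alpha], and it
minimizes [k * alpha + beta], hence [beta] at the given [alpha].  For
[alpha = 0] the threshold is infinite: H0 is accepted exactly on [q > 0], and
optimality is the limit [k -> +oo] of the previous comparison.  Both optimality
claims and that of the Bayes test are instances of [likelihood_ratio_optimal].

With the boundary attained, the line at level [c] is below the boundary iff
every risk is at least [c], and it moreover touches it iff [c] is the BER,
the contact being at the Bayes test.  For a level [c] at or above the BER, the
upper bound supported by the line is the convex function that is finite only at
the false positive rate of the Bayes test, where it takes the height of the
line. *)

Set Implicit Arguments.
Unset Strict Implicit.

Import HBNNSimple.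

(** * Integration against a density *)

(** On indicators this is the definition of a density; it passes to simple
functions by linearity and to [f] by monotone convergence.  The proof is direct,
without the Radon-Nikodym theorem, because [lambda] need not be sigma-finite. *)
Lemma ge0_integral_density d (T : measurableType d) (R : realType)
    (lambda : {measure set T -> \bar R}) (P : probability T R) (p : T -> R)
    (f : T -> \bar R) :
  is_density lambda P p -> measurable_fun setT f -> (forall x, 0 <= f x)%E ->
  (\int[P]_x f x = \int[lambda]_x (f x * (p x)%:E))%E.
Proof.
move=> [mp p0 Pp] mf f0.
have mEp : measurable_fun setT (EFin \o p) by exact/measurable_EFinP.
pose h := nnsfun_approx measurableT mf.
have hf x : (EFin \o h^~ x) @ \oo --> f x by exact: cvg_nnsfun_approx.
have ndh x : nondecreasing_seq (h^~ x).
  by move=> m n mn; exact/lefP/nd_nnsfun_approx.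
rewrite (nd_ge0_integral_lim _ f0 ndh hf).
have -> : (\int[lambda]_x (f x * (p x)%:E) =
    lim (\int[lambda]_x ((h n x)%:E * (p x)%:E) @[n --> \oo]))%E.
  rewrite -monotone_convergence//.
  - apply: eq_integral => x _; apply/esym/cvg_lim => //.
    exact: cvgeZr (hf x).
  - by move=> n; apply: emeasurable_funM => //; exact/measurable_EFinP.
  - by move=> n x _; rewrite mule_ge0 ?lee_fin.
  - by move=> x _ m n mn; rewrite lee_wpmul2r ?lee_fin//; exact: ndh.
congr (lim (_ @ \oo)); apply/funext => n /=.
have indic_density r : (\int[lambda]_x ((\1_(h n @^-1` [set r]) x)%:E * (p x)%:E) =
    P (h n @^-1` [set r]))%E.
  rewrite Pp// [RHS]integral_mkcond; apply: eq_integral => x _.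
  by rewrite muleC epatch_indic.
rewrite sintegralE.
under eq_integral => x _.
  rewrite fimfunE -fsumEFin// ge0_mule_fsuml; last first.
    by move=> r; rewrite EFinM nnfun_muleindic_ge0.
  over.
rewrite ge0_integral_fsum//=; last 2 first.
- by move=> r; apply: emeasurable_funM => //; exact/measurable_EFinP/measurable_funM.
- by move=> r x _; rewrite mule_ge0 ?EFinM ?nnfun_muleindic_ge0 ?lee_fin.
apply: eq_fsbigr => r /set_mem[x _ <-].
rewrite -indic_density -ge0_integralZl//.
- by apply: eq_integral => y _; rewrite EFinM muleA.
- by apply: emeasurable_funM => //; exact/measurable_EFinP.
- by move=> y _; rewrite mule_ge0 ?lee_fin.
- by rewrite lee_fin.
Qed.

Lemma measurable_lt_set d (T : measurableType d) (R : realType) (f g : T -> R) :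
  measurable_fun setT f -> measurable_fun setT g ->
  measurable [set x | f x < g x].
Proof. by move=> mf mg; rewrite -[X in measurable X]setTI; exact: measurable_fun_ltr. Qed.

Lemma measurable_le_set d (T : measurableType d) (R : realType) (f g : T -> R) :
  measurable_fun setT f -> measurable_fun setT g ->
  measurable [set x | f x <= g x].
Proof. by move=> mf mg; rewrite -[X in measurable X]setTI; exact: measurable_fun_ler. Qed.

(** Almost surely for [Q], the likelihood ratio [p / q] is finite. *)
Lemma density_null d (T : measurableType d) (R : realType)
    (lambda : {measure set T -> \bar R}) (Q : probability T R) (q : T -> R) :
  is_density lambda Q q -> Q [set x | q x <= 0] = 0%E.
Proof.
move=> [mq q0 ->]; last exact: measurable_le_set.
by apply: integral0_eq => x /= qx; congr EFin; apply/eqP; rewrite eq_le qx q0.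
Qed.

(** * Error rates of tests *)

Lemma test_integrable d (T : measurableType d) (R : realType)
    (P : probability T R) (phi : T -> R) :
  is_test phi -> P.-integrable setT (EFin \o phi).
Proof.
move=> [mphi phi01].
apply: (le_integrable measurableT _ _ (finite_measure_integrable_cst P 1 measurableT)).
- exact/measurable_EFinP.
- by move=> x _; case/andP: (phi01 x) => ? ?; rewrite /= lee_fin normr1 ger0_norm.
Qed.

Lemma false_positive_rateE d (T : measurableType d) (R : realType)
    (Q : probability T R) (phi : T -> R) :
  is_test phi -> false_positive_rate Q phi = 1 - \int[Q]_x phi x.
Proof.
move=> tphi; rewrite /false_positive_rate RintegralB//; last 2 first.
- exact: finite_measure_integrable_cst.
- exact: test_integrable.
by rewrite Rintegral_cst// mul1r; congr (_ - _); exact: (congr1 fine (probability_setT Q)).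
Qed.

Lemma false_positive_rate_itv d (T : measurableType d) (R : realType)
    (Q : probability T R) (phi : T -> R) :
  is_test phi -> 0 <= false_positive_rate Q phi <= 1.
Proof.
move=> tphi; have [_ phi01] := tphi; apply/andP; split.
  by apply: Rintegral_ge0 => x _; rewrite subr_ge0; case/andP: (phi01 x).
rewrite false_positive_rateE// lerBlDr lerDl; apply: Rintegral_ge0 => x _.
by case/andP: (phi01 x).
Qed.

Lemma nonrandomized_test d (T : measurableType d) (R : realType) (E : set T) :
  measurable E -> is_test (\1_(~` E) : T -> R).
Proof.
move=> mE; split; first by apply: measurable_indic; exact: measurableC.
by move=> x; rewrite indicE; case: (_ \in _); rewrite /= ?lexx ?ler01.
Qed.

Lemma Rintegral_indic d (T : measurableType d) (R : realType)
    (P : probability T R) (A : set T) :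
  measurable A -> \int[P]_x (\1_A x : R) = fine (P A).
Proof. by move=> mA; rewrite /Rintegral integral_indic// setIT. Qed.

Lemma false_positive_rate_indic d (T : measurableType d) (R : realType)
    (Q : probability T R) (E : set T) :
  measurable E -> false_positive_rate Q (\1_(~` E)) = fine (Q E).
Proof.
move=> mE; rewrite false_positive_rateE; last exact: nonrandomized_test.
rewrite Rintegral_indic; last exact: measurableC.
by rewrite probability_setC// fineB ?fin_num_measure//=; lra.
Qed.

Lemma false_negative_rate_indic d (T : measurableType d) (R : realType)
    (P : probability T R) (E : set T) :
  measurable E -> false_negative_rate P (\1_(~` E)) = fine (P (~` E)).
Proof. by move=> mE; rewrite /false_negative_rate Rintegral_indic//; exact: measurableC. Qed.

Lemma is_test_mix d (T : measurableType d) (R : realType) (t : R) (phi psi : T -> R) :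
  0 <= t <= 1 -> is_test phi -> is_test psi ->
  is_test (fun x => (1 - t) * phi x + t * psi x).
Proof.
move=> /andP[t0 t1] [mphi phi01] [mpsi psi01]; split.
  by apply: measurable_funD; exact: measurable_funM.
by move=> x; move: (phi01 x) (psi01 x) => /andP[? ?] /andP[? ?]; apply/andP; split; nra.
Qed.

Lemma false_positive_rate_mix d (T : measurableType d) (R : realType)
    (Q : probability T R) (t : R) (phi psi : T -> R) :
  0 <= t <= 1 -> is_test phi -> is_test psi ->
  false_positive_rate Q (fun x => (1 - t) * phi x + t * psi x) =
  (1 - t) * false_positive_rate Q phi + t * false_positive_rate Q psi.
Proof.
move=> t01 tphi tpsi; rewrite !false_positive_rateE//; last exact: is_test_mix.
have iphi := test_integrable Q tphi; have ipsi := test_integrable Q tpsi.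
rewrite RintegralD//; last 2 first.
- exact: (integrableZl measurableT (1 - t) iphi).
- exact: (integrableZl measurableT t ipsi).
rewrite !RintegralZl//; lra.
Qed.

(** * Optimality of likelihood-ratio tests *)

(** In terms of [lambda] the difference of the two sides is the integral of
[(phi' - phi) * (a * p - b * q)].  To stay with nonnegative integrands, the
proof compares [a * phi * p + b * phi' * q] with [a * phi' * p + b * phi * q]
instead. *)
Lemma likelihood_ratio_optimal d (T : measurableType d) (R : realType)
    (lambda : {measure set T -> \bar R}) (P Q : probability T R) (p q : T -> R)
    (a b : R) (phi phi' : T -> R) :
  is_density lambda P p -> is_density lambda Q q -> 0 <= a -> 0 <= b ->
  is_test phi -> is_test phi' ->
  (forall x, 0 <= (phi' x - phi x) * (a * p x - b * q x)) ->
  b * false_positive_rate Q phi + a * false_negative_rate P phi <=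
  b * false_positive_rate Q phi' + a * false_negative_rate P phi'.
Proof.
move=> dp dq a0 b0 tphi tphi' sgn.
have [[mphi phi01] [mphi' phi'01]] := (tphi, tphi').
have [[mp p0 _] [mq q0 _]] := (dp, dq).
have weighted (M : probability T R) (m psi : T -> R) (w : R) :
    is_density lambda M m -> is_test psi -> 0 <= w ->
    ((w * \int[M]_x psi x)%:E = \int[lambda]_x (w * (psi x * m x))%:E)%E.
  move=> dm tpsi w0; have [mpsi psi01] := tpsi; have [mm m0 _] := dm.
  have psi0 x : 0 <= psi x by case/andP: (psi01 x).
  have ipsi := integrable_fin_num measurableT (test_integrable M tpsi).
  rewrite EFinM fineK// (ge0_integral_density dm)//=.
  - rewrite -ge0_integralZl//.
    + by apply/measurable_EFinP; exact: measurable_funM.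
    + by move=> x _; rewrite lee_fin mulr_ge0.
  exact/measurable_EFinP.
rewrite !false_positive_rateE// /false_negative_rate.
suff : a * (\int[P]_x phi x) + b * (\int[Q]_x phi' x) <=
       a * (\int[P]_x phi' x) + b * (\int[Q]_x phi x) by lra.
have mweight (w : R) (psi m : T -> R) : measurable_fun setT psi ->
    measurable_fun setT m -> measurable_fun setT (fun x => (w * (psi x * m x))%:E).
  by move=> ? ?; apply/measurable_EFinP/measurable_funM => //; exact: measurable_funM.
have weight_ge0 (w : R) (psi m : T -> R) x : 0 <= w -> 0 <= psi x <= 1 -> 0 <= m x ->
    (0 <= (w * (psi x * m x))%:E)%E.
  by move=> w0 /andP[psi0 _] m0; rewrite lee_fin !mulr_ge0.
rewrite -lee_fin 2!EFinD !(weighted P p, weighted Q q)//.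
rewrite -!ge0_integralD//; try by move=> x _; exact: weight_ge0.
2-5: exact: mweight.
apply: ge0_le_integral => //.
- by move=> x _; apply: adde_ge0; exact: weight_ge0.
- by apply: emeasurable_funD; exact: mweight.
- by apply: emeasurable_funD; exact: mweight.
- by move=> x _; rewrite lee_fin; move: (sgn x); lra.
Qed.

(** Accepting H0 off [v < u] satisfies the sign condition of
[likelihood_ratio_optimal], whatever the value [y] of the competing test. *)
Lemma lt_test_sign (T : Type) (R : realType) (u v : T -> R) (y : R) (x : T) :
  0 <= y <= 1 -> 0 <= (y - \1_(~` [set z | v z < u z]) x) * (u x - v x).
Proof.
move=> /andP[y0 y1]; rewrite indicE in_setC.
have [vu|uv] := ltP (v x) (u x).
  by rewrite mem_set//= subr0 mulr_ge0// subr_ge0 ltW.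
by rewrite memNset//= ?mulr_le0 ?subr_le0//; apply/negP; rewrite -leNgt.
Qed.

Lemma le_test_sign (T : Type) (R : realType) (u v : T -> R) (y : R) (x : T) :
  0 <= y <= 1 -> 0 <= (y - \1_(~` [set z | v z <= u z]) x) * (u x - v x).
Proof.
move=> /andP[y0 y1]; rewrite indicE in_setC.
have [vu|uv] := leP (v x) (u x).
  by rewrite mem_set//= subr0 mulr_ge0// subr_ge0.
by rewrite memNset//= ?mulr_le0 ?subr_le0 ?(ltW uv)//; apply/negP; rewrite -ltNge.
Qed.

(** * Existence of a likelihood-ratio threshold *)

Lemma measure_bigcup_le d (T : measurableType d) (R : realType)
    (mu : {measure set T -> \bar R}) (F : (set T)^nat) (a : \bar R) :
  (forall n, measurable (F n)) -> nondecreasing_seq F ->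
  (forall n, mu (F n) <= a)%E -> (mu (\bigcup_n F n) <= a)%E.
Proof.
move=> mF ndF Fa; apply: (cvge_to_le (nondecreasing_cvg_mu mF _ ndF)).
  exact: bigcup_measurable.
exact: nearW.
Qed.

Lemma measure_bigcap_ge d (T : measurableType d) (R : realType)
    (P : probability T R) (F : (set T)^nat) (a : \bar R) :
  (forall n, measurable (F n)) -> nonincreasing_seq F ->
  (forall n, a <= P (F n))%E -> (a <= P (\bigcap_n F n))%E.
Proof.
move=> mF niF Fa; apply: (cvge_to_ge (nonincreasing_cvg_mu _ mF _ niF)).
- by rewrite ltey_eq fin_num_measure.
- exact: bigcap_measurableType.
- exact: nearW.
Qed.

Lemma invS_mul_lt (R : realType) (y e : R) : 0 <= y -> 0 < e ->
  exists n, n.+1%:R^-1 * y < e.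
Proof.
move=> y0 e0; exists (Num.bound (y / e)).
rewrite mulrC ltr_pdivrMr ?ltr0n// mulrC -ltr_pdivrMr//.
apply: lt_trans (archi_boundP _) _; first by rewrite divr_ge0// ltW.
by rewrite ltr_nat.
Qed.

Lemma natr_mul_ge (R : realType) (y e : R) : 0 <= y -> 0 < e ->
  exists n : nat, y <= n%:R * e.
Proof.
move=> y0 e0; exists (Num.bound (y / e)); rewrite -ler_pdivrMr//.
by apply/ltW/archi_boundP; rewrite divr_ge0// ltW.
Qed.

(** The function [k |-> Q (p > k q)] is nonincreasing and tends to 0, since
[q > 0] almost surely for [Q]; [k] is the infimum of the nonnegative points
where it is at most [alpha].  Continuity of [Q] from below gives the first
inequality, since [Q (p > l q) <= alpha] for [l > k].  If [k > 0], continuity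
from above gives the second, since [Q (p > l q) > alpha] for [0 <= l < k]; if
[k = 0], the set [p >= k q] is the whole space.  For [alpha = 0] there may be
no finite threshold. *)
Lemma likelihood_threshold d (T : measurableType d) (R : realType)
    (lambda : {measure set T -> \bar R}) (Q : probability T R) (p q : T -> R)
    (alpha : R) :
  is_density lambda Q q -> measurable_fun setT p -> (forall x, 0 <= p x) ->
  0 < alpha <= 1 ->
  exists2 k : R, 0 <= k &
    (Q [set x | (k * q x < p x)%R] <= alpha%:E <= Q [set x | (k * q x <= p x)%R])%E.
Proof.
move=> dq mp p0 /andP[alpha0 alpha1].
have [mq q0 _] := dq.
have mkq (k : R) : measurable_fun setT (fun x => k * q x) by exact: measurable_funM.
pose G k := [set x | k * q x < p x].
have mG k : measurable (G k) by exact: measurable_lt_set.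
have niG k l : k <= l -> G l `<=` G k.
  by move=> kl x; apply: le_lt_trans; rewrite ler_wpM2r.
have QG k l : k <= l -> (Q (G l) <= Q (G k))%E.
  by move=> kl; rewrite le_measure ?inE//; exact: niG.
pose S := [set k : R | 0 <= k /\ (Q (G k) <= alpha%:E)%E].
have [k Sk] : S !=set0.
  apply: contrapT => S0.
  suff : (alpha%:E <= Q (\bigcap_n G n%:R))%E.
    apply/negP; rewrite -ltNge (le_lt_trans _ (_ : 0%E < _)%E) ?lte_fin//.
    rewrite -(density_null dq) le_measure ?inE//.
    - exact: bigcap_measurableType.
    - exact: measurable_le_set.
    move=> x Gx /=; rewrite leNgt; apply/negP => qx.
    by have [n] := natr_mul_ge (p0 x) qx; rewrite leNgt (Gx n).
  apply: measure_bigcap_ge => //.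
    by move=> m n mn; apply/subsetPset/niG; rewrite ler_nat.
  move=> n; apply/ltW; rewrite ltNge; apply/negP => Gn.
  by apply: S0; exists n%:R; split.
have lbS : lbound S 0 by move=> l [].
have k0 : 0 <= inf S by apply: lb_le_inf => //; exists k.
have aboveS (l : R) : inf S < l -> (Q (G l) <= alpha%:E)%E.
  move=> infl; have [m [_ Gm] ml] := inf_lt (ex_intro _ k Sk) infl.
  exact: le_trans (QG _ _ (ltW ml)) Gm.
exists (inf S) => //; apply/andP; split.
- have -> : [set x | inf S * q x < p x] = \bigcup_n G (inf S + n.+1%:R^-1).
    apply/seteqP; split => [x /= px|x [n _]]; last first.
      by apply: niG; rewrite lerDl.
    have [||n nx] := @invS_mul_lt R (q x) (p x - inf S * q x) => //.
      by rewrite subr_gt0.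
    by exists n => //; rewrite /G /= mulrDl -ltrBrDl.
  apply: measure_bigcup_le => //.
    move=> m n mn; apply/subsetPset/niG; rewrite lerD2l lef_pV2 ?posrE//.
    by rewrite ler_nat.
  by move=> n; apply: aboveS; rewrite ltrDl.
- have [k1|k1] := eqVneq (inf S) 0.
    rewrite k1 (_ : [set x | _] = setT) ?probability_setT ?lee_fin//.
    by apply/seteqP; split => // x _ /=; rewrite mul0r.
  have {}k0 : 0 < inf S by rewrite lt_neqAle eq_sym k1.
  (* Approaching inf S proportionally keeps l n nonnegative, so that l n would
     belong to S if Q (G (l n)) were at most alpha. *)
  pose l n := inf S - n.+1%:R^-1 * inf S.
  have l0 n : 0 <= l n.
    by rewrite subr_ge0 ler_piMl ?invf_le1 ?ler1n// ltW.
  apply: (@le_trans _ _ (Q (\bigcap_n G (l n)))).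
    apply: measure_bigcap_ge => //.
      move=> m n mn; apply/subsetPset/niG; rewrite lerD2l lerN2 ler_wpM2r ?(ltW k0)//.
      by rewrite lef_pV2 ?posrE// ler_nat.
    move=> n; apply/ltW; rewrite ltNge; apply/negP => Gn.
    have /(ge_inf _) : S (l n) by split.
    move=> /(_ (ex_intro _ _ lbS)); rewrite leNgt => /negP; apply.
    by rewrite ltrBlDr ltrDl mulr_gt0.
  rewrite le_measure ?inE//.
  - exact: bigcap_measurableType.
  - exact: measurable_le_set.
  move=> x Gx /=; rewrite leNgt; apply/negP => px.
  have [||n] := @invS_mul_lt R (inf S * q x) (inf S * q x - p x).
  - by rewrite mulr_ge0// ltW.
  - by rewrite subr_gt0.
  - move=> le; have := Gx n I; rewrite /G/= /l mulrBl -mulrA ltNge => /negP.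
    by apply; rewrite lerBrDl -lerBrDr ltW.
Qed.

(** * The Neyman-Pearson boundary is attained *)

(** The competitors have false positive rate exactly [alpha], as in
[NP_boundary], which is why the optimal test has to be randomized so as to reach
[alpha] exactly. *)
Lemma neyman_pearson d (T : measurableType d) (R : realType)
    (lambda : {measure set T -> \bar R}) (P Q : probability T R) (p q : T -> R)
    (alpha : R) :
  is_density lambda P p -> is_density lambda Q q -> 0 <= alpha <= 1 ->
  exists phi, [/\ is_test phi, false_positive_rate Q phi = alpha &
    forall phi', is_test phi' -> false_positive_rate Q phi' = alpha ->
      false_negative_rate P phi <= false_negative_rate P phi'].
Proof.
move=> dp dq /andP[alpha0 alpha1].
have [[mp p0 _] [mq q0 _]] := (dp, dq).
have mkq (k : R) : measurable_fun setT (fun x => k * q x) by exact: measurable_funM.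
have mG k : measurable [set x | k * q x < p x] by exact: measurable_lt_set.
have mG' k : measurable [set x | k * q x <= p x] by exact: measurable_le_set.
have mN : measurable [set x | q x <= 0] by exact: measurable_le_set.
have [alpha00|alphaN0] := eqVneq alpha 0.
  exists (\1_(~` [set x | q x <= 0])); split.
  - exact: nonrandomized_test.
  - by rewrite false_positive_rate_indic// (density_null dq) alpha00.
  move=> phi' tphi' fphi'; rewrite false_negative_rate_indic//.
  rewrite -lee_fin fineK ?fin_num_measure//; last exact: measurableC.
  (* Every finite threshold n gives P (p <= n q) <= false_negative_rate P phi',
     because phi' has false positive rate 0; these sets increase to a set containing q > 0. *)
  have mH (n : nat) : measurable (~` [set x | n%:R * q x < p x]).
    exact: measurableC.
  apply: (@le_trans _ _ (P (\bigcup_n ~` [set x | n%:R * q x < p x]))).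
    rewrite le_measure ?inE//.
    - exact: measurableC.
    - exact: bigcup_measurable.
    move=> x /= /negP; rewrite -ltNge => qx.
    have [n nx] := natr_mul_ge (p0 x) qx.
    by exists n => //=; apply/negP; rewrite -leNgt.
  apply: measure_bigcup_le => // [m n mn|n].
    apply/subsetPset/subsetC => x /=; apply: le_lt_trans.
    by rewrite ler_wpM2r// ler_nat.
  rewrite -[leLHS]fineK ?fin_num_measure// lee_fin -false_negative_rate_indic//.
  have tn := nonrandomized_test R (mG n%:R).
  have [fn0 _] := andP (false_positive_rate_itv Q tn).
  have sgn x : 0 <= (phi' x - \1_(~` [set z | n%:R * q z < p z]) x) *
      (1 * p x - n%:R * q x).
    by rewrite mul1r; exact: (lt_test_sign p (fun z => n%:R * q z) x (tphi'.2 x)).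
  have := likelihood_ratio_optimal dp dq ler01 (ler0n R n) tn tphi' sgn.
  rewrite fphi' alpha00 mulr0 add0r !mul1r; apply: le_trans.
  by rewrite lerDr mulr_ge0.
have alpha01 : 0 < alpha <= 1 by rewrite lt_neqAle eq_sym alphaN0 alpha0.
have [k k0 /andP[Gk G'k]] := likelihood_threshold dq mp p0 alpha01.
move: Gk G'k.
rewrite -[X in (X <= _)%E -> _]fineK ?fin_num_measure// lee_fin.
rewrite -[X in (_ <= X)%E -> _]fineK ?fin_num_measure// lee_fin.
rewrite -!false_positive_rate_indic//.
set phi0 : T -> R := \1_(~` [set x | k * q x < p x]).
set phi1 : T -> R := \1_(~` [set x | k * q x <= p x]).
have t0 : is_test phi0 by exact: nonrandomized_test.
have t1 : is_test phi1 by exact: nonrandomized_test.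
set A := false_positive_rate Q phi0; set B := false_positive_rate Q phi1 => Aa aB.
(* Mixing the tests that accept and reject H0 on the tie p = k q reaches every
   false positive rate between theirs. *)
have [t t01 tAB] : exists2 t : R, 0 <= t <= 1 & (1 - t) * A + t * B = alpha.
  have [AB|AB] := eqVneq A B.
    by exists 0; [rewrite lexx ler01|move: AB Aa aB; lra].
  have ABgt : 0 < B - A by rewrite subr_gt0 lt_neqAle AB (le_trans Aa).
  exists ((alpha - A) / (B - A)); last by field; rewrite gt_eqF.
  by rewrite divr_ge0 ?subr_ge0 ?(le_trans Aa)// ler_pdivrMr// mul1r lerB.
exists (fun x => (1 - t) * phi0 x + t * phi1 x).
have tmix := is_test_mix t01 t0 t1.
split => //; first by rewrite false_positive_rate_mix.
move=> phi' tphi' fphi'.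
have sgn x : 0 <= (phi' x - ((1 - t) * phi0 x + t * phi1 x)) * (1 * p x - k * q x).
  have -> : (phi' x - ((1 - t) * phi0 x + t * phi1 x)) * (1 * p x - k * q x) =
      (1 - t) * ((phi' x - phi0 x) * (p x - k * q x)) +
      t * ((phi' x - phi1 x) * (p x - k * q x)) by ring.
  case/andP: t01 => t_ge0 t_le1.
  apply: addr_ge0; rewrite mulr_ge0 ?subr_ge0//.
  - exact: (lt_test_sign p (fun z => k * q z) x (tphi'.2 x)).
  - exact: (le_test_sign p (fun z => k * q z) x (tphi'.2 x)).
have := likelihood_ratio_optimal dp dq ler01 k0 tmix tphi' sgn.
by rewrite fphi' false_positive_rate_mix// tAB !mul1r lerD2l.
Qed.

Lemma minimum_eq (R : realType) (S : set R) (m : R) :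
  S m -> lbound S m -> minimum S = m.
Proof.
move=> Sm lbm; apply: xget_unique => // m' [Sm' lbm'].
by apply/eqP; rewrite eq_le lbm// lbm'.
Qed.

Lemma NP_boundary_attained d (T : measurableType d) (R : realType)
    (lambda : {measure set T -> \bar R}) (P Q : probability T R) (p q : T -> R)
    (alpha : R) :
  is_density lambda P p -> is_density lambda Q q -> 0 <= alpha <= 1 ->
  NP_region P Q (alpha, NP_boundary P Q alpha) /\
  forall beta, NP_region P Q (alpha, beta) -> NP_boundary P Q alpha <= beta.
Proof.
move=> dp dq a01; have [phi [tphi fphi phi_min]] := neyman_pearson dp dq a01.
have reg : NP_region P Q (alpha, false_negative_rate P phi).
  by exists phi => //; rewrite fphi.
have lb : lbound [set beta | NP_region P Q (alpha, beta)] (false_negative_rate P phi).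
  by move=> beta [phi' tphi' [fphi' <-]]; exact: phi_min.
by rewrite /NP_boundary (minimum_eq reg lb); split => // beta; exact: lb.
Qed.

(** * The Bayes error rate as the least risk over all tests *)

(** Randomization does not lower the risk: its integrand is affine in the value
of the test, hence smallest at 0 or 1, pointwise. *)
Lemma BER_min_risk d (T : measurableType d) (R : realType)
    (lambda : {measure set T -> \bar R}) (P Q : probability T R) (p q : T -> R)
    (pi_p pi_q : R) :
  is_density lambda P p -> is_density lambda Q q -> 0 <= pi_p -> 0 <= pi_q ->
  (forall alpha beta, NP_region P Q (alpha, beta) ->
     BER lambda p q pi_p pi_q <= pi_q * alpha + pi_p * beta) /\
  exists alpha beta, NP_region P Q (alpha, beta) /\
     BER lambda p q pi_p pi_q = pi_q * alpha + pi_p * beta.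
Proof.
move=> dp dq pp0 pq0.
have [[mp p0 Pp] [mq q0 Qq]] := (dp, dq).
pose E := [set x | pi_q * q x < pi_p * p x].
have mE : measurable E by apply: measurable_lt_set; exact: measurable_funM.
have riskE F : measurable F ->
    pi_q * (\int[lambda]_(x in F) q x) + pi_p * (\int[lambda]_(x in ~` F) p x) =
    pi_q * false_positive_rate Q (\1_(~` F)) +
    pi_p * false_negative_rate P (\1_(~` F)).
  move=> mF; rewrite false_positive_rate_indic// false_negative_rate_indic//.
  by rewrite Qq// Pp//; exact: measurableC.
have bayes phi : is_test phi ->
    pi_q * false_positive_rate Q (\1_(~` E)) + pi_p * false_negative_rate P (\1_(~` E))
    <= pi_q * false_positive_rate Q phi + pi_p * false_negative_rate P phi.
  move=> tphi; apply: (likelihood_ratio_optimal dp dq) => //.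
    exact: nonrandomized_test.
  move=> x.
  exact: (lt_test_sign (fun z => pi_p * p z) (fun z => pi_q * q z) x (tphi.2 x)).
have BERE : BER lambda p q pi_p pi_q =
    pi_q * false_positive_rate Q (\1_(~` E)) + pi_p * false_negative_rate P (\1_(~` E)).
  apply: minimum_eq; first by exists E => //; rewrite riskE.
  by move=> _ [F mF <-]; rewrite riskE//; apply: bayes; exact: nonrandomized_test.
split; first by move=> alpha beta [phi tphi [<- <-]]; rewrite BERE; exact: bayes.
exists (false_positive_rate Q (\1_(~` E))), (false_negative_rate P (\1_(~` E))).
by split => //; exists (\1_(~` E)) => //; exact: nonrandomized_test.
Qed.

Theorem proposition4 (d : measure_display) (T : measurableType d) (R : realType)
    (lambda : {measure set T -> \bar R}) (P Q : probability T R)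
    (p q : T -> R) (hp : is_density lambda P p) (hq : is_density lambda Q q)
    (pi_p pi_q c : R) (hpi_p : 0 < pi_p < 1) (hpi_q : 0 < pi_q < 1)
    (hpi : pi_p + pi_q = 1) :
  [/\ supporting_line (line pi_p pi_q c) (fun a => (NP_boundary P Q a)%:E)
        <-> BER lambda p q pi_p pi_q = c,
      line_below (line pi_p pi_q c) (fun a => (NP_boundary P Q a)%:E)
        <-> c <= BER lambda p q pi_p pi_q &
      (exists g : R -> \bar R, boundary_upper_bound (NP_boundary P Q) g /\
          supporting_line (line pi_p pi_q c) g)
        <-> BER lambda p q pi_p pi_q <= c].
Proof.
have [pp0 pq0] : 0 < pi_p /\ 0 < pi_q by case/andP: hpi_p; case/andP: hpi_q.
have [BERmin [a0 [b0 [reg0 BER0]]]] := BER_min_risk hp hq (ltW pp0) (ltW pq0).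
have a001 : 0 <= a0 <= 1.
  by have [phi tphi [<- _]] := reg0; exact: false_positive_rate_itv.
have attained a (a01 : 0 <= a <= 1) := NP_boundary_attained hp hq a01.
have Bmin (a : R) : 0 <= a <= 1 ->
    BER lambda p q pi_p pi_q <= pi_q * a + pi_p * NP_boundary P Q a.
  by move=> a01; apply: BERmin; exact: (attained a a01).1.
have risk_le (a b b' : R) : (pi_q * a + pi_p * b <= pi_q * a + pi_p * b') = (b <= b').
  by rewrite lerD2l ler_pM2l.
have B0 : NP_boundary P Q a0 = b0.
  apply/eqP; rewrite eq_le (attained a0 a001).2//=.
  by rewrite -(risk_le a0) -BER0 Bmin.
(* The height of the line above the false positive rate of the Bayes test. *)
pose b1 := (c - pi_q * a0) / pi_p.
have l1 : c = pi_q * a0 + pi_p * b1.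
  by rewrite /b1 mulrCA divff ?gt_eqF// mulr1 addrC subrK.
have below : line_below (line pi_p pi_q c) (fun a => (NP_boundary P Q a)%:E)
    <-> c <= BER lambda p q pi_p pi_q.
  split => [lb|cBER a b a01 lab].
    by rewrite l1 BER0 risk_le -B0 -lee_fin; exact: lb.
  by rewrite lee_fin -(risk_le a) -[leLHS]lab (le_trans cBER)// Bmin.
split => //.
- split => [[/below cBER [a [b [a01 lab [bB]]]]]|cE].
    by apply/eqP; rewrite eq_le cBER andbT lab/= bB Bmin.
  split; first by apply/below; rewrite cE.
  by exists a0, b0; rewrite B0 /line/= -BER0 cE.
- split => [[g [[_ _ Bg] [_ [a [b [a01 lab bg]]]]]]|BERc].
    rewrite lab (le_trans (Bmin _ a01))//= risk_le -lee_fin bg.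
    exact: Bg.
  (* Finite at one point only, g is convex; at a0 it is above the boundary since
     the level c of the line is at least the BER. *)
  pose g a : \bar R := if a == a0 then b1%:E else +oo%E.
  have gNy a : (-oo < g a)%E by rewrite /g; case: ifP; rewrite ?ltNyr.
  exists g; split; last first.
    split; last by exists a0, b1; rewrite /g eqxx.
    move=> a b _ lab; rewrite /g; case: eqVneq => [aa0|_]; last exact: leey.
    by rewrite lee_fin -(risk_le a0) -l1 [leRHS]lab aa0.
  split => // [x y t _ _ /andP[t0 t1]|a _]; last first.
    rewrite /g; case: eqVneq => [->|_]; last exact: leey.
    by rewrite B0 lee_fin -(risk_le a0) -BER0 -l1.
  have [->|tN0] := eqVneq t 0.
    by rewrite mul0r add0r subr0 mul1r mul0e add0e mul1e.
  have [->|tN1] := eqVneq t 1.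
    by rewrite subrr mul1r mul0r addr0 mul1e mul0e adde0.
  have {tN0}t_gt0 : 0 < t by rewrite lt_neqAle eq_sym tN0.
  have {tN1}t_lt1 : 0 < 1 - t by rewrite subr_gt0 lt_neqAle tN1.
  have weightNy (w : R) a : 0 < w -> (w%:E * g a != -oo)%E.
    rewrite /g => w0; case: ifP => _; first by rewrite -EFinM.
    by rewrite gt0_muley ?lte_fin.
  have [->|xa] := eqVneq x a0; last first.
    by rewrite [X in (_ * X + _)%E]/g (negbTE xa) gt0_muley ?lte_fin// addye ?leey ?weightNy.
  have [->|ya] := eqVneq y a0; last first.
    by rewrite [X in (_ + _ * X)%E]/g (negbTE ya) gt0_muley ?lte_fin// addey ?leey ?weightNy.
  rewrite -mulrDl addrC subrK mul1r /g eqxx -!EFinM -EFinD lee_fin.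
  by rewrite -mulrDl addrC subrK mul1r.
Qed.
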